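(* Let $R=\mathbb{M}_{2}(\mathbb{Z})$. A matrix $A\in R\setminus U(R)$ has stable range 1 in $R$ if and only if $\det (A)=0$.
   Context: $\mathbb{M}_2(\mathbb{Z})$ is the ring of $2\times 2$ integer matrices. For a unital ring $S$, $U(S)$ denotes its group of units. An element $a\in S$ has left stable range 1 if whenever $Sa+Sb=S$ for some $b\in S$, there is $y\in S$ with $a+yb\in U(S)$; it has right stable range 1 if whenever $aS+bS=S$ for some $b\in S$, there is $y\in S$ with $a+by\in U(S)$; it has stable range 1 if it has both left and right stable range 1. *)

(* Defs.v *)
From mathcomp Require Import all_boot all_order all_algebra.

Set Implicit Arguments.
Unset Strict Implicit.
Unset Printing Implicit Defensive.

Import GRing.Theory.
Local Open Scope ring_scope.

(* S a + S b = S *)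
Definition left_comaximal (S : unitRingType) (a b : S) : Prop :=
  forall s : S, exists u v : S, s = u * a + v * b.

(* a S + b S = S *)
Definition right_comaximal (S : unitRingType) (a b : S) : Prop :=
  forall s : S, exists u v : S, s = a * u + b * v.

Definition left_stable_range1 (S : unitRingType) (a : S) : Prop :=
  forall b : S, left_comaximal a b ->
    exists y : S, a + y * b \is a GRing.unit.

Definition right_stable_range1 (S : unitRingType) (a : S) : Prop :=
  forall b : S, right_comaximal a b ->
    exists y : S, a + b * y \is a GRing.unit.

Definition stable_range1 (S : unitRingType) (a : S) : Prop :=
  left_stable_range1 a /\ right_stable_range1 a.

(* Main.v *)
Require Import Defs.
From mathcomp Require Import all_boot all_order all_algebra.
From mathcomp Require Import ring zify.

(** A square matrix over the integers is a unit exactly when its determinant is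
    1 or -1, so everything is about which determinants [A + Y B] can reach.

    If [\det A = D] is neither 0 nor a unit, take for [B] the scalar matrix
    [N = D ^ 2 + 1].  It is comaximal with [A], because [D] and [N] are coprime
    and the scalar matrix [D] is a left multiple of [A], by its adjugate; but
    [\det (A + N Y)] is congruent to [D] modulo [N], while [D] is too small
    compared with [N] to be congruent to 1 or -1 ([left_stable_range1_det0]).

    If [\det A = 0], stable range 1 is invariant under multiplication by units,
    so the Smith normal form reduces the question to [diag (d, 0)]; transposition
    exchanges the two sides, so only left stable range 1 is needed.  There
    [\det (A + Y B) = d (y B_2) + \det Y \det B], where [y] is the second row of
    [Y] and [B_2] the second column of [B].  Writing [B_2 = g c] with [c]
    unimodular, [y] can be chosen unimodular with [y c] any prescribed integer
    [k], and the first row of [Y] then gives [\det Y] any prescribed value [m].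
    Hence [\det (A + Y B)] takes every value [d g k + \det B m], and taking the
    determinant of the comaximality relation [U A + V B = 1] shows that 1 is one
    of these values ([diag_left_stable_range1]). *)

Set Implicit Arguments.
Unset Strict Implicit.
Unset Printing Implicit Defensive.

Import GRing.Theory.
Local Open Scope ring_scope.

Lemma left_comaximalP (S : unitRingType) (a b : S) :
  left_comaximal a b <-> exists u v : S, u * a + v * b = 1.
Proof.
split=> [/(_ 1) [u [v def1]] | [u [v def1]] s]; first by exists u, v.
by exists (s * u), (s * v); rewrite -!mulrA -mulrDr def1 mulr1.
Qed.

(** A witness [y] for [a] and [b / q] yields the witness [p y] for [p a q] and
    [b]; comaximality transfers because it only concerns left ideals up to the
    right factor [q]. *)
Lemma left_stable_range1_mul_unit (S : unitRingType) (p a q : S) :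
    p \is a GRing.unit -> q \is a GRing.unit ->
  left_stable_range1 a -> left_stable_range1 (p * a * q).
Proof.
move=> Up Uq sr_a b /left_comaximalP[u [v def1]].
have /sr_a[y Uy]: left_comaximal a (b * q^-1).
  apply/left_comaximalP; exists (q * u * p), (q * v).
  apply: (mulIr Uq); rewrite mul1r -[RHS]mulr1 -def1.
  by rewrite mulrDl mulrDr !mulrA (mulrVK Uq).
exists (p * y).
have ->: p * a * q + p * y * b = p * (a + y * (b * q^-1)) * q.
  by rewrite mulrDr mulrDl !mulrA (mulrVK Uq).
by rewrite unitrMl // unitrMr.
Qed.

Lemma det_mx22 (R : comPzRingType) (M : 'M[R]_2) :
  \det M = M 0 0 * M 1 1 - M 0 1 * M 1 0.
Proof.
rewrite (expand_det_row _ 0) !big_ord_recl big_ord0 /cofactor !det_mx11 !mxE /=.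
have -> : lift 0 0 = 1 :> 'I_2 by apply: val_inj.
have -> : lift 1 0 = 0 :> 'I_2 by apply: val_inj.
by rewrite expr0 expr1; ring.
Qed.

Lemma mulmx22E (R : pzSemiRingType) m n (M : 'M[R]_(m, 2)) (N : 'M[R]_(2, n)) i j :
  (M *m N) i j = M i 0 * N 0 j + M i 1 * N 1 j.
Proof.
rewrite !mxE !big_ord_recl big_ord0 addr0.
by have -> : lift 0 0 = 1 :> 'I_2 by apply: val_inj.
Qed.

Lemma det_diag0 (R : comPzRingType) (d : R) (M : 'M[R]_2) :
  \det (diag_mx (\row_j (d *+ (j == 0))) + M) = d * M 1 1 + \det M.
Proof. by rewrite !det_mx22 !mxE /= !mulr1n !mulr0n; ring. Qed.

Lemma unimodular_decomposition (b c : int) :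
  exists g b' c' u v : int, [/\ b = g * b', c = g * c' & u * b' + v * c' = 1].
Proof.
have [u [v bez]] := Bezoutz b c.
have [g0 | g_neq0] := eqVneq (gcdz b c) 0.
  have /eqP := g0; rewrite gcdz_eq0 => /andP[/eqP-> /eqP->].
  by exists 0, 1, 0, 1, 0; split; ring.
have /dvdzP[b' def_b] := dvdz_gcdl b c.
have /dvdzP[c' def_c] := dvdz_gcdr b c.
exists (gcdz b c), b', c', u, v; split; [by rewrite mulrC | by rewrite mulrC |].
by apply: (mulIf g_neq0); rewrite mul1r mulrDl -!mulrA -def_b -def_c.
Qed.

(** The rows of the witness are [m (u, v)] and [k (u, v) + (- c2, c1)], where
    [c = (c1, c2)] is the unimodular direction of the second column of [B] and
    [(u, v)] are its Bezout coefficients.  Since [(u, v)] and [(- c2, c1)] form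
    a basis of determinant 1, its determinant is [m]; its second row pairs with
    [c] to [k]. *)
Lemma diag_left_stable_range1 (d : int) :
  left_stable_range1 (diag_mx (\row_(j < 2) (d *+ (j == 0)))).
Proof.
set A := diag_mx _ => B /left_comaximalP[U [V def1]].
have [g [c1 [c2 [u [v [B01 B11 cop]]]]]] :=
  unimodular_decomposition (B 0 1) (B 1 1).
(* k and m are read off the expansion of det (U A + V B) = 1. *)
pose m := \det V.
pose k := U 0 0 * (V 1 0 * c1 + V 1 1 * c2) - U 1 0 * (V 0 0 * c1 + V 0 1 * c2).
have dgk : d * g * k + m * \det B = 1.
  have <- : \det (U * A + V * B) = 1 by rewrite def1 det1.
  rewrite !det_mx22 ![(U * A + _) _ _]mxE !mulmx22E B01 B11.
  rewrite ![A _ _]mxE !mxE /= !mulr1n !mulr0n /k /m det_mx22.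
  ring.
pose Y : 'M[int]_2 := \matrix_(i, j)
  if i == 0 then (if j == 0 then m * u else m * v)
  else if j == 0 then k * u - c2 else k * v + c1.
exists Y.
rewrite [_ \is a _]unitmxE det_diag0 det_mulmx mulmx22E B01 B11.
have -> : \det Y = m.
  rewrite det_mx22 !mxE /=.
  by rewrite -[RHS]mulr1 -cop; ring.
rewrite !mxE /=.
suff -> : d * ((k * u - c2) * (g * c1) + (k * v + c1) * (g * c2)) = d * g * k.
  by rewrite dgk unitr1.
by rewrite -[RHS]mulr1 -cop; ring.
Qed.

Lemma det0_left_stable_range1 (A : 'M[int]_2) :
  \det A = 0 -> left_stable_range1 A.
Proof.
move=> detA0.
have [L UL [R UR [d d_sorted defA]]] := int_Smith_normal_form A.
have d1_0 : d`_1 = 0.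
  have : d`_0 * d`_1 = 0.
    move: detA0; rewrite defA !det_mulmx.
    rewrite [X in _ * X * _]det_mx22 !mxE /= !mulr1n !mulr0n mul0r subr0 => /eqP; rewrite !mulf_eq0.
    rewrite !unitmxE in UL UR.
    case/orP => [/orP[/eqP detL0|/orP[]/eqP->]|/eqP detR0]; rewrite ?mul0r ?mulr0 //.
      by rewrite detL0 unitr0 in UL.
    by rewrite detR0 unitr0 in UR.
  case: d d_sorted {defA} => [|x [|y d]] //= /andP[x_dvd_y _] /eqP.
  rewrite mulf_eq0 => /orP[]/eqP // x0.
  have : (x %| y)%Z by [].
  by rewrite x0 dvd0z => /eqP.
suff -> : A = L * diag_mx (\row_(j < 2) (d`_0 *+ (j == 0))) * R.
  by apply: left_stable_range1_mul_unit => //; apply: diag_left_stable_range1.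
rewrite [LHS]defA; congr (_ *m _ *m _); apply/matrixP=> i j; rewrite !mxE.
by case: i j => [[|[]]// ?] [[|[]]// ?]; rewrite /= ?d1_0 ?mulr1n ?mulr0n.
Qed.

Lemma trmx_unit (R : comUnitRingType) n (M : 'M[R]_n.+1) :
  (M^T \is a GRing.unit) = (M \is a GRing.unit).
Proof. exact: unitmx_tr. Qed.

Lemma trmx_right_stable_range1 (R : comUnitRingType) n (A : 'M[R]_n.+1) :
  left_stable_range1 A^T -> right_stable_range1 A.
Proof.
move=> srA B comAB.
have [|Y] := srA B^T.
  move=> M; have [U [V defM]] := comAB M^T; exists U^T, V^T.
  by rewrite -[LHS]trmxK defM linearD /= !trmx_mul.
by exists Y^T; rewrite -trmx_unit linearD /= [(B * _)^T]trmx_mul trmxK.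
Qed.

(** If [D] is neither 0 nor a unit then [|D| >= 2], so that [D ^ 2 - |D| >= 2]:
    the value is [D] itself for [t = 0], and is at least 3 in absolute value
    otherwise. *)
Lemma unit_mod_sqr_add1 (D t : int) :
  D + (D ^+ 2 + 1) * t \is a GRing.unit -> D = 0 \/ D \is a GRing.unit.
Proof.
have unitzE (x : int) : (x \is a GRing.unit) = (x == 1) || (x == -1) by [].
rewrite !unitzE.
have [t0 | t_neq0] := eqVneq t 0; first by rewrite t0 mulr0 addr0; right.
have [D0 | D_neq0] := eqVneq D 0; first by left.
move=> unitDt; right; apply: contraTT unitDt => nunitD.
have D_large : D ^+ 2 >= 2 * D /\ D ^+ 2 >= - 2 * D /\ D ^+ 2 >= 4.
  have [D_ge2 | D_le2] : D >= 2 \/ D <= -2 by lia.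
    by rewrite expr2; nia.
  by rewrite expr2; nia.
have [t_gt0 | t_lt0] : t >= 1 \/ t <= -1 by lia.
  have : (D ^+ 2 + 1) * t >= D ^+ 2 + 1 by nia.
  lia.
have : (D ^+ 2 + 1) * t <= - (D ^+ 2 + 1) by nia.
lia.
Qed.

Lemma left_stable_range1_det0 (A : 'M[int]_2) :
  A \isn't a GRing.unit -> left_stable_range1 A -> \det A = 0.
Proof.
move=> nUA srA; set D := \det A; set N := D ^+ 2 + 1.
have [|Y] := srA N%:M.
  apply/left_comaximalP; exists (- D *: \adj A), 1%:M.
  rewrite -[_ * A]scalemxAl mul_adj_mx -/D scale_scalar_mx.
  rewrite [1%:M * _]mul1mx -raddfD.
  by congr _%:M; rewrite /N; ring.
rewrite [Y * _]mul_mx_scalar [_ \is a _]unitmxE.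
have -> : \det (A + N *: Y) = D + N *
  (A 0 0 * Y 1 1 + Y 0 0 * A 1 1 - A 0 1 * Y 1 0 - Y 0 1 * A 1 0 + N * \det Y).
  by rewrite /D !det_mx22 !mxE; ring.
case/unit_mod_sqr_add1 => // UD.
by rewrite [_ \is a _]unitmxE UD in nUA.
Qed.

Theorem theorem11 (A : 'M[int]_2) (hA : A \isn't a GRing.unit) :
  stable_range1 A <-> \det A = 0.
Proof.
split=> [[srA _] | detA0]; first exact: left_stable_range1_det0.
split; first exact: det0_left_stable_range1.
by apply/trmx_right_stable_range1/det0_left_stable_range1; rewrite det_tr.
Qed.
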